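(* Let $g_\sigma:\mathbb R^{n_1\times n_2}\to\mathbb R$ be a $\mathcal C^2$ function whose gradient $\nabla g_\sigma$ is $L_{g_\sigma}$-Lipschitz, let $\gamma\in[0,1]$ with $\gamma L_{g_\sigma}<1$, let $a>0$ and let $b\in\mathbb R$ be a constant (added entrywise to matrices). Put $\mathcal D_\sigma^\gamma=\mathrm{Id}-\gamma\nabla g_\sigma$ and define the shifted denoiser $$\widetilde{\mathcal D}_\sigma^\gamma(Z)=\frac1a\left[\mathcal D_\sigma^\gamma(aZ+b)-b\right],\qquad Z\in\mathbb R^{n_1\times n_2}.$$ Let $\widetilde\phi_\sigma^\gamma(Z)=\frac1{a^2}\phi_\sigma^\gamma(aZ+b)$, where $\phi_\sigma^\gamma$ is the potential defined in the context. Then $\widetilde{\mathcal D}_\sigma^\gamma(Z)=\operatorname{prox}_{\widetilde\phi_\sigma^\gamma}(Z)$ for all $Z\in\mathbb R^{n_1\times n_2}$, and $\widetilde\phi_\sigma^\gamma$ is $\frac{\gamma L_{g_\sigma}}{\gamma L_{g_\sigma}+1}$-weakly convex.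
   Context: The map $\mathcal D_\sigma^\gamma=\mathrm{Id}-\gamma\nabla g_\sigma$ is injective since $\gamma L_{g_\sigma}<1$. The potential $\phi_\sigma^\gamma:\mathbb R^{n_1\times n_2}\to(-\infty,+\infty]$ is defined by $\phi_\sigma^\gamma(X)=\gamma g_\sigma((\mathcal D_\sigma^\gamma)^{-1}(X))-\frac12\|(\mathcal D_\sigma^\gamma)^{-1}(X)-X\|_F^2$ if $X\in\operatorname{Im}(\mathcal D_\sigma^\gamma)$, and $+\infty$ otherwise. For a function $f$, $\operatorname{prox}_f(Z)=\arg\min_U\left[f(U)+\frac12\|U-Z\|_F^2\right]$ (a set in general; the asserted equality means that the minimizer is unique and equals the left-hand side). A function $f$ is $\rho$-weakly convex ($\rho\ge0$) if $f+\frac\rho2\|\cdot\|_F^2$ is convex. *)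

(* Defs.v *)
From HB Require Import structures.
From mathcomp Require Import all_boot all_order all_algebra.
From mathcomp Require Import all_classical all_reals all_analysis.

Set Implicit Arguments.
Unset Strict Implicit.
Unset Printing Implicit Defensive.

Import Order.TTheory GRing.Theory Num.Theory.
Import numFieldNormedType.Exports.

Local Open Scope classical_set_scope.
Local Open Scope ring_scope.

Section FrobeniusSpace.
Context {R : realType} {m n : nat}.
Implicit Types X Y Z U V : 'M[R]_(m, n).

(* The library norm `|X| on matrices is the sup norm; it induces the same
   topology and the same differentials, but not the same Lipschitz constants,
   hence this separate Euclidean norm. *)
Definition frobenius_norm X : R := Num.sqrt (\sum_i \sum_j X i j ^+ 2).

(* The representative of the differential for the Frobenius inner product,
   i.e. the matrix of partial derivatives. *)
Definition gradient (g : 'M[R]_(m, n) -> R) X : 'M[R]_(m, n) :=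
  \matrix_(i, j) 'D_(delta_mx i j) g X.

(* g and its gradient are Frechet differentiable, and the second differential
   is continuous; in finite dimension its continuity in the operator norm is
   continuity at each direction H. *)
Definition C2 (g : 'M[R]_(m, n) -> R) : Prop :=
  [/\ forall X, differentiable g X,
      forall X, differentiable (gradient g) X &
      forall H, continuous (fun X => 'd (gradient g) X H)].

Definition frobenius_lipschitz (L : R) (F : 'M[R]_(m, n) -> 'M[R]_(m, n)) :=
  forall X Y, frobenius_norm (F X - F Y) <= L * frobenius_norm (X - Y).

(* Meant for f with values in ]-oo, +oo]. With the convention 0 * +oo = 0 the
   inequality is trivial at t = 0 and t = 1. *)
Definition econvex (f : 'M[R]_(m, n) -> \bar R) : Prop :=
  forall X Y (t : R), 0 <= t <= 1 ->
    (f (t *: X + (1 - t) *: Y)%R <= t%:E * f X + (1 - t)%:E * f Y)%E.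

Definition weakly_convex (rho : R) (f : 'M[R]_(m, n) -> \bar R) : Prop :=
  0 <= rho /\
  econvex (fun X => (f X + (rho / 2 * frobenius_norm X ^+ 2)%:E)%E).

(* The set of all (global) minimizers, so that uniqueness of the minimizer is
   equality with a singleton. *)
Definition prox (f : 'M[R]_(m, n) -> \bar R) Z : set 'M[R]_(m, n) :=
  [set U | forall V,
    (f U + (2^-1 * frobenius_norm (U - Z) ^+ 2)%:E <=
     f V + (2^-1 * frobenius_norm (V - Z) ^+ 2)%:E)%E].

Definition denoiser (g : 'M[R]_(m, n) -> R) (gamma : R) X : 'M[R]_(m, n) :=
  X - gamma *: gradient g X.

(* The preimage of X when X is in the range of an injective denoiser; only
   used there. *)
Definition denoiser_inv (g : 'M[R]_(m, n) -> R) (gamma : R) :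
    'M[R]_(m, n) -> 'M[R]_(m, n) :=
  'pinv_(fun=> 0) setT (denoiser g gamma).

Definition potential (g : 'M[R]_(m, n) -> R) (gamma : R) X : \bar R :=
  if X \in range (denoiser g gamma) then
    (gamma * g (denoiser_inv g gamma X)
     - 2^-1 * frobenius_norm (denoiser_inv g gamma X - X) ^+ 2)%:E
  else +oo%E.

Definition shifted_denoiser (g : 'M[R]_(m, n) -> R) (gamma a b : R) Z :
    'M[R]_(m, n) :=
  a^-1 *: (denoiser g gamma (a *: Z + const_mx b) - const_mx b).

Definition shifted_potential (g : 'M[R]_(m, n) -> R) (gamma a b : R) Z :
    \bar R :=
  ((a ^- 2)%:E * potential g gamma (a *: Z + const_mx b)%R)%E.

Lemma shifted_potential_gtNy g gamma a b Z : 0 < a ->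
  (-oo < shifted_potential g gamma a b Z)%E.
Proof.
move=> a0; rewrite /shifted_potential /potential.
case: ifP => _; first by rewrite -EFinM ltNyr.
by rewrite gt0_muley// lte_fin invr_gt0 exprn_gt0.
Qed.

End FrobeniusSpace.

(* Main.v *)
Require Import Defs.
From HB Require Import structures.
From mathcomp Require Import all_boot all_order all_algebra.
From mathcomp Require Import all_classical all_reals all_analysis.
From mathcomp Require Import ring lra.
Import Order.TTheory GRing.Theory Num.Theory.
Import numFieldNormedType.Exports.
Local Open Scope classical_set_scope.
Local Open Scope ring_scope.

(** Lipschitz continuity of the gradient bounds [g] above and below by quadratic
    models. As [gamma * L < 1], the map [D = Id - gamma * gradient g] is a
    bijection (Banach fixed point), so the potential is finite everywhere and
    can be computed in the variable [Y = D^-1 X]. The upper model shows that [Z]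
    is, in this variable, the strict minimizer of the proximal objective at [Z].
    The lower model is the smoothness of [psi = |.|^2/2 - gamma g], and
    [potential + |.|^2/2] is the Legendre conjugate of [psi], hence
    [1 / (1 + gamma L)]-strongly convex. Both conclusions are transported along
    the affine bijection [Z |-> a Z + b]. *)

(** Joins the complete and the normed structures on matrices, as [banach_fixed_point] requires. *)
HB.instance Definition _ (R : realType) (m n : nat) :=
  Complete.on 'M[R]_(m, n).

(** * Frobenius inner product and comparison with the sup norm *)

Section FrobeniusInnerProduct.
Context {R : realType} {m n : nat}.
Implicit Types (X Y Z : 'M[R]_(m, n)) (k : R).

Definition frobenius_dot X Y : R := \sum_i \sum_j X i j * Y i j.

Lemma frobenius_dotC X Y : frobenius_dot X Y = frobenius_dot Y X.
Proof. by apply: eq_bigr => i _; apply: eq_bigr => j _; rewrite mulrC. Qed.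

Lemma frobenius_dotDl X Y Z :
  frobenius_dot (X + Y) Z = frobenius_dot X Z + frobenius_dot Y Z.
Proof.
rewrite -big_split; apply: eq_bigr => i _; rewrite -big_split.
by apply: eq_bigr => j _; rewrite mxE mulrDl.
Qed.

Lemma frobenius_dotZl k X Y :
  frobenius_dot (k *: X) Y = k * frobenius_dot X Y.
Proof.
rewrite mulr_sumr; apply: eq_bigr => i _; rewrite mulr_sumr.
by apply: eq_bigr => j _; rewrite mxE mulrA.
Qed.

Lemma frobenius_dotNl X Y : frobenius_dot (- X) Y = - frobenius_dot X Y.
Proof. by rewrite -scaleN1r frobenius_dotZl mulN1r. Qed.

Lemma frobenius_dotDr X Y Z :
  frobenius_dot X (Y + Z) = frobenius_dot X Y + frobenius_dot X Z.
Proof. by rewrite frobenius_dotC frobenius_dotDl !(frobenius_dotC X). Qed.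

Lemma frobenius_dotZr k X Y :
  frobenius_dot X (k *: Y) = k * frobenius_dot X Y.
Proof. by rewrite frobenius_dotC frobenius_dotZl (frobenius_dotC X). Qed.

Lemma frobenius_dotNr X Y : frobenius_dot X (- Y) = - frobenius_dot X Y.
Proof. by rewrite -scaleN1r frobenius_dotZr mulN1r. Qed.

Definition frobenius_dotE :=
  (frobenius_dotDl, frobenius_dotDr, frobenius_dotNl, frobenius_dotNr,
   frobenius_dotZl, frobenius_dotZr).

Lemma frobenius_dot_ge0 X : 0 <= frobenius_dot X X.
Proof.
by apply: sumr_ge0 => i _; apply: sumr_ge0 => j _; rewrite -expr2 sqr_ge0.
Qed.

Lemma frobenius_dot_eq0 X : frobenius_dot X X = 0 -> X = 0.
Proof.
move=> /eqP; rewrite psumr_eq0 => [/allP X0|i _]; last first.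
  by apply: sumr_ge0 => j _; rewrite -expr2 sqr_ge0.
apply/matrixP => i j; rewrite mxE.
have := X0 i (mem_index_enum i); rewrite psumr_eq0 => [/allP|k _]; last first.
  by rewrite -expr2 sqr_ge0.
by move=> /(_ j (mem_index_enum j)); rewrite /= mulf_eq0 orbb => /eqP.
Qed.

Lemma frobenius_normE X : frobenius_norm X = Num.sqrt (frobenius_dot X X).
Proof. by []. Qed.

Lemma sqr_frobenius_norm X : frobenius_norm X ^+ 2 = frobenius_dot X X.
Proof. by rewrite frobenius_normE sqr_sqrtr ?frobenius_dot_ge0. Qed.

Lemma frobenius_norm_ge0 X : 0 <= frobenius_norm X.
Proof. exact: sqrtr_ge0. Qed.

Lemma frobenius_norm_eq0 X : frobenius_norm X = 0 -> X = 0.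
Proof.
by move=> X0; apply: frobenius_dot_eq0; rewrite -sqr_frobenius_norm X0 expr0n.
Qed.

Lemma frobenius_normZ k X :
  frobenius_norm (k *: X) = `|k| * frobenius_norm X.
Proof.
rewrite !frobenius_normE frobenius_dotZl frobenius_dotZr mulrA -expr2.
by rewrite sqrtrM ?sqr_ge0// sqrtr_sqr.
Qed.

Lemma frobenius_cauchy_schwarz X Y :
  frobenius_dot X Y <= frobenius_norm X * frobenius_norm Y.
Proof.
have [/frobenius_norm_eq0->|/eqP X0] := eqVneq (frobenius_norm X) 0.
  rewrite -(scale0r 0) frobenius_dotZl mul0r.
  by rewrite mulr_ge0 ?frobenius_norm_ge0.
have [/frobenius_norm_eq0->|/eqP Y0] := eqVneq (frobenius_norm Y) 0.
  rewrite -(scale0r 0) frobenius_dotZr mul0r.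
  by rewrite mulr_ge0 ?frobenius_norm_ge0.
have pq0 : 0 < frobenius_norm X * frobenius_norm Y.
  by rewrite mulr_gt0// lt0r frobenius_norm_ge0 andbT; exact/eqP.
(* This square expands to [2 |X| |Y| (|X| |Y| - <X, Y>)]. *)
have := frobenius_dot_ge0 (frobenius_norm Y *: X - frobenius_norm X *: Y).
rewrite !frobenius_dotE -!sqr_frobenius_norm (frobenius_dotC Y X) => h.
rewrite -(ler_pM2l pq0); lra.
Qed.

Lemma mx_norm_le_frobenius X : `|X| <= frobenius_norm X.
Proof.
rewrite [`|X|]mx_normrE; apply: bigmax_le => [|[i j] _ /=].
  exact: frobenius_norm_ge0.
rewrite -sqrtr_sqr ler_sqrt ?frobenius_dot_ge0//.
rewrite (bigD1 i)//= (bigD1 j)//= -addrA lerDl addr_ge0//.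
  by apply: sumr_ge0 => k _; rewrite sqr_ge0.
by apply: sumr_ge0 => k _; apply: sumr_ge0 => l _; rewrite sqr_ge0.
Qed.

Lemma frobenius_le_mx_norm X :
  frobenius_norm X <= Num.sqrt (m * n)%:R * `|X|.
Proof.
rewrite -[`|X|]ger0_norm// -sqrtr_sqr -sqrtrM ?ler0n//.
rewrite ler_sqrt ?mulr_ge0 ?ler0n ?sqr_ge0//.
apply: (@le_trans _ _ (\sum_(i < m) \sum_(j < n) `|X| ^+ 2)); last first.
  by rewrite !sumr_const !card_ord -mulrnA mulr_natl mulnC.
apply: ler_sum => i _; apply: ler_sum => j _.
rewrite -real_normK ?num_real// lerXn2r ?nnegrE//.
rewrite [leRHS]mx_normrE.
exact: (le_bigmax_cond _ (fun ij : 'I_m * 'I_n => `|X ij.1 ij.2|) (j := (i, j))).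
Qed.

End FrobeniusInnerProduct.

(** * Quadratic models from a Lipschitz gradient *)

Section GradientBounds.
Context {R : realType} {m n : nat}.
Variables (g : 'M[R]_(m, n) -> R) (L : R).
Implicit Types X Y Z V : 'M[R]_(m, n).

Lemma derive_gradient X V : differentiable g X ->
  'D_V g X = frobenius_dot (gradient g X) V.
Proof.
move=> dg; rewrite deriveE// [V in LHS]matrix_sum_delta linear_sum.
apply: eq_bigr => i _; rewrite linear_sum; apply: eq_bigr => j _.
by rewrite linearZ -deriveE// mxE mulrC.
Qed.

Lemma is_derive_line X V (t : R) : differentiable g (X + t *: V) ->
  is_derive t 1 (fun s : R => g (X + s *: V))
    (frobenius_dot (gradient g (X + t *: V)) V).
Proof.
move=> dg.
have quotE : (fun h : R => h^-1 *: ((fun s => g (X + s *: V)) (h *: 1 + t)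
      - g (X + t *: V))) =
    (fun h : R => h^-1 *: (g (h *: V + (X + t *: V)) - g (X + t *: V))).
  apply/funext => h; congr (_ *: (g _ - _)).
  by rewrite scalerDl [h *: 1]mulr1 addrCA.
have dgV : derivable g (X + t *: V) V by exact: diff_derivable.
rewrite -(derive_gradient _ V dg); split.
  by move: dgV; rewrite /derivable/= quotE.
by rewrite /derive/= quotE.
Qed.

Hypothesis gC1 : forall X, differentiable g X.
Hypothesis gL : frobenius_lipschitz L (gradient g).

(** A factor [s] of either sign yields the upper and the lower model at once. Monotonicity of [f]
    along the segment from [X] to [Y] replaces the integral form of the remainder. *)
Lemma gradient_remainder (s : R) X Y :
  s * (g Y - g X - frobenius_dot (gradient g X) (Y - X)) <=
  `|s| * L / 2 * frobenius_dot (Y - X) (Y - X).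
Proof.
pose V := Y - X.
pose c := frobenius_dot (gradient g X) V.
pose N := frobenius_dot V V.
pose f (t : R) : R := s * g (X + t *: V) - (s * c) * t - `|s| * L * N / 2 * t ^+ 2.
have df (t : R) : is_derive t 1 f
    (s * (frobenius_dot (gradient g (X + t *: V)) V - c) - `|s| * L * N * t).
  have dl := @is_derive_line X V t (gC1 _).
  apply: is_derive_eq.
  rewrite /= ?mulr0 ?addr0 /GRing.scale/=.
  by field.
have : f 1 <= f 0.
  apply: (@ler0_derive1_le_cc _ f 0 1) => //; rewrite ?in_itv/= ?lexx ?ler01//.
  - move=> t; rewrite in_itv/= derive1E; rewrite (@derive_val _ _ _ _ _ _ _ (df t)).
    move=> /andP[t0 _]; rewrite subr_le0.
    (* By Cauchy-Schwarz and the Lipschitz bound, the first term of the derivative is at most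
       [|s| * L * t * N]. *)
    rewrite /c -frobenius_dotNl -frobenius_dotDl -frobenius_dotZl.
    apply: (le_trans (frobenius_cauchy_schwarz _ _)).
    rewrite frobenius_normZ -!mulrA ler_wpM2l//.
    have /(ler_wpM2r (frobenius_norm_ge0 V)) := gL (X + t *: V) X.
    rewrite [X + _ - X]addrAC subrr add0r frobenius_normZ gtr0_norm//.
    move=> /le_trans; apply; rewrite /N -sqr_frobenius_norm; lra.
  - apply: derivable_within_continuous => t _; exact: (@ex_derive _ _ _ _ _ _ _ (df t)).
rewrite /f scale1r scale0r addr0 mulr0 expr0n mulr0 !subr0 mulr1 expr1n mulr1.
rewrite /c /N /V subrKC; lra.
Qed.

End GradientBounds.

(** * Fixed points of Frobenius contractions *)

Section LipschitzFixedPoint.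
Context {R : realType} {m n : nat}.
Implicit Types (F : 'M[R]_(m, n) -> 'M[R]_(m, n)) (q : R).

Lemma frobenius_lipschitz_iter q F k : 0 <= q -> frobenius_lipschitz q F ->
  frobenius_lipschitz (q ^+ k) (iter k F).
Proof.
move=> q0 qF X Y; elim: k => [|k IH]; first by rewrite expr0 mul1r.
by rewrite (le_trans (qF _ _))// exprS -mulrA ler_wpM2l.
Qed.

(* The library makes matrices a complete space for the sup norm only, which a
   high enough iterate of [F] contracts. *)
Lemma frobenius_lipschitz_fixed_point q F : 0 <= q < 1 ->
  frobenius_lipschitz q F -> exists X, F X = X.
Proof.
move=> /andP[q0 q1] qF.
pose C : R := Num.sqrt (m * n)%:R.
(* [C] is the cost of passing between the two norms; the geometric decay of [q ^+ k] absorbs it. *)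
have [k kC] : exists k, C * q ^+ k < 1.
  have : C * q ^+ k @[k --> \oo] --> (0 : R).
    by apply: cvg_geometric; rewrite ger0_norm.
  move=> /cvgr0_norm_lt /(_ _ ltr01)[k _ /(_ k (leqnn k))] Ck.
  by exists k; rewrite (le_lt_trans (ler_norm _)).
have Cq0 : 0 <= C * q ^+ k by rewrite mulr_ge0 ?sqrtr_ge0 ?exprn_ge0.
have ctr : is_contraction (totalfun (iter k F) : {fun setT >-> setT}).
  exists (NngNum Cq0); split => // -[X Y] _ /=.
  rewrite (le_trans (mx_norm_le_frobenius _))//.
  rewrite (le_trans (frobenius_lipschitz_iter _ _ k q0 qF _ _))//.
  rewrite [leRHS]mulrAC [leRHS]mulrC.
  by rewrite ler_wpM2l ?exprn_ge0// frobenius_le_mx_norm.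
have [X _ XE] := banach_fixed_point ctr closedT (ex_intro _ 0 I).
(* [F] commutes with its iterates, so [F X] is fixed by [iter k F] too and equals [X] by
   uniqueness. *)
exists X; apply: (contraction_fixpoint_unique ctr) => //.
change (F X = iter k F (F X)); rewrite -iterSr iterS.
by congr F.
Qed.

End LipschitzFixedPoint.

(** * Bijectivity of the denoiser and its energy *)

Section Denoiser.
Context {R : realType} {m n : nat}.
Variables (g : 'M[R]_(m, n) -> R) (L gamma : R).
Hypothesis gC1 : forall X, differentiable g X.
Hypothesis L0 : 0 <= L.
Hypothesis gL : frobenius_lipschitz L (gradient g).
Hypothesis gamma0 : 0 <= gamma.
Hypothesis gammaL : gamma * L < 1.
Implicit Types X Y Z : 'M[R]_(m, n).
Local Notation D := (denoiser g gamma).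

Let scaled_gradient_lipschitz Z :
  frobenius_lipschitz (gamma * L) (fun X => Z + gamma *: gradient g X).
Proof.
move=> X Y; rewrite /= opprD addrACA subrr add0r -scalerBr.
by rewrite frobenius_normZ ger0_norm// -mulrA ler_wpM2l.
Qed.

(** A preimage of [Z] is a fixed point of the contraction [X |-> Z + gamma *: gradient g X]. *)
Lemma denoiser_surj Z : exists X, D X = Z.
Proof.
have [|X XE] := frobenius_lipschitz_fixed_point _ _ _ (scaled_gradient_lipschitz Z).
  by rewrite gammaL mulr_ge0.
by exists X; apply/eqP; rewrite subr_eq; exact/eqP/esym.
Qed.

Let gradientE Y : gamma *: gradient g Y = Y - D Y.
Proof. by rewrite /denoiser subKr. Qed.

Lemma denoiser_inj : injective D.
Proof.
move=> X Y XY; apply/eqP; rewrite -subr_eq0; apply/eqP/frobenius_norm_eq0.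
have := scaled_gradient_lipschitz 0 X Y.
rewrite /= !add0r !gradientE XY; move: (D Y) => W; rewrite opprB addrA subrK => XYle.
apply/eqP; rewrite eq_le frobenius_norm_ge0 andbT.
have g1 : 0 < 1 - gamma * L by rewrite subr_gt0.
by rewrite -(pmulr_rle0 _ g1) mulrBl mul1r subr_le0.
Qed.

(* [denoiser_energy Y] is the value of the potential at [D Y]; expressing the
   potential in the preimage variable avoids inverting [D]. *)
Definition denoiser_energy Y : R :=
  gamma * g Y - 2^-1 * frobenius_dot (Y - D Y) (Y - D Y).

Lemma potential_denoiser Y : potential g gamma (D Y) = (denoiser_energy Y)%:E.
Proof.
rewrite /potential /denoiser_inv ifT; last by rewrite inE; exists Y.
by rewrite pinvKV ?inE// => [|? ? _ _ /denoiser_inj//]; rewrite sqr_frobenius_norm.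
Qed.

Let upper_bound X Y : gamma * g Y <=
  gamma * g X + frobenius_dot (X - D X) (Y - X)
  + gamma * L / 2 * frobenius_dot (Y - X) (Y - X).
Proof.
have := gradient_remainder _ _ gC1 gL gamma X Y.
rewrite ger0_norm// -gradientE frobenius_dotZl; lra.
Qed.

Let lower_bound X Y :
  gamma * g X + frobenius_dot (X - D X) (Y - X)
  - gamma * L / 2 * frobenius_dot (Y - X) (Y - X) <= gamma * g Y.
Proof.
have := gradient_remainder _ _ gC1 gL (- gamma) X Y.
rewrite normrN ger0_norm// -gradientE frobenius_dotZl; lra.
Qed.

(** Once squares are expanded, this is the upper model at [Y] evaluated at [Z]: the left energy
    terms reduce to [gamma * g Z]. The gap term gives uniqueness of the minimizer. *)
Lemma denoiser_energy_gap Y Z :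
  denoiser_energy Z + 2^-1 * frobenius_dot (D Z - Z) (D Z - Z)
  + (1 - gamma * L) / 2 * frobenius_dot (Y - Z) (Y - Z) <=
  denoiser_energy Y + 2^-1 * frobenius_dot (D Y - Z) (D Y - Z).
Proof.
have := upper_bound Y Z; rewrite /denoiser_energy.
set A := D Y; set B := D Z; move: A B => A B.
rewrite !frobenius_dotE (frobenius_dotC A Y) (frobenius_dotC A Z)
  (frobenius_dotC B Z) (frobenius_dotC Z Y).
lra.
Qed.

(* [U] maximizes the lower bound on the conjugate [sup_U <U, D W> - psi U]
   obtained from the quadratic upper model of [psi] at [Y]. *)
Lemma denoiser_energy_support Y W (mu := (1 + gamma * L)^-1) :
  denoiser_energy Y + 2^-1 * frobenius_dot (D Y) (D Y)
  + frobenius_dot Y (D W - D Y)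
  + mu / 2 * frobenius_dot (D W - D Y) (D W - D Y) <=
  denoiser_energy W + 2^-1 * frobenius_dot (D W) (D W).
Proof.
pose U := Y + mu *: (D W - D Y).
have gL0 : 0 <= gamma * L by rewrite mulr_ge0.
have muE : gamma * L * mu ^+ 2 = mu - mu ^+ 2.
  by rewrite /mu; field; rewrite gt_eqF// ltr_wpDr.
(* Relaxing [gamma * L] to 1 turns the upper model into convexity of [psi], that is
   [<U, D W> - psi U <= <W, D W> - psi W]. *)
have h1 : gamma * g U <= gamma * g W + frobenius_dot (W - D W) (U - W)
    + 2^-1 * frobenius_dot (U - W) (U - W).
  rewrite (le_trans (upper_bound W U))// lerD2l ler_wpM2r ?frobenius_dot_ge0//.
  by rewrite -[leRHS]mul1r ler_wpM2r ?invr_ge0 ?ler0n// ltW.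
have := lower_bound Y U; rewrite [U - Y]addrAC subrr add0r.
have -> : gamma * L / 2
      * frobenius_dot (mu *: (D W - D Y)) (mu *: (D W - D Y)) =
    (mu - mu ^+ 2) / 2 * frobenius_dot (D W - D Y) (D W - D Y).
  by rewrite frobenius_dotZl frobenius_dotZr -muE; field.
move: h1; rewrite /denoiser_energy /U.
move: (D Y) (D W) => B A {muE U}; move: mu => mu.
rewrite !frobenius_dotE (frobenius_dotC A B) (frobenius_dotC W A)
  (frobenius_dotC W B) (frobenius_dotC Y A) (frobenius_dotC Y B)
  (frobenius_dotC Y W).
lra.
Qed.

(** Averaging the support inequality at [X1] and [X2] cancels its linear term. Removing [|.|^2/2]
    from a [mu]-strongly convex function leaves the modulus [1 - mu]. *)
Lemma denoiser_energy_semiconvex Y X1 X2 (t : R) : 0 <= t <= 1 ->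
  D Y = t *: D X1 + (1 - t) *: D X2 ->
  denoiser_energy Y <= t * denoiser_energy X1 + (1 - t) * denoiser_energy X2
    + gamma * L / (gamma * L + 1) / 2 * (t * (1 - t))
      * frobenius_dot (D X1 - D X2) (D X1 - D X2).
Proof.
move=> /andP[t0 t1] DY.
have t1' : 0 <= 1 - t by rewrite subr_ge0.
have := lerD (ler_wpM2l t0 (denoiser_energy_support Y X1))
  (ler_wpM2l t1' (denoiser_energy_support Y X2)).
have -> : gamma * L / (gamma * L + 1) = 1 - (1 + gamma * L)^-1.
  rewrite (addrC 1 (gamma * L)); field.
  by rewrite gt_eqF// (lt_le_trans ltr01)// lerDr mulr_ge0.
rewrite DY; move: (D X1) (D X2) (1 + gamma * L)^-1 => A B mu.
rewrite -subr_ge0 => /le_trans S; rewrite -subr_ge0; apply: S.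
rewrite !frobenius_dotE (frobenius_dotC B A) le_eqVlt.
apply/orP; left; apply/eqP.
move: (denoiser_energy Y) (denoiser_energy X1) (denoiser_energy X2).
move: (frobenius_dot Y A) (frobenius_dot Y B).
move: (frobenius_dot A A) (frobenius_dot A B) (frobenius_dot B B).
by move=> *; field.
Qed.

End Denoiser.

(** * Transport to the shifted denoiser *)

Theorem mainTheorem7 (R : realType) (n1 n2 : nat)
    (g : 'M[R]_(n1, n2) -> R) (L gamma a b : R) :
  C2 g -> 0 <= L -> frobenius_lipschitz L (gradient g) ->
  0 <= gamma <= 1 -> gamma * L < 1 -> 0 < a ->
  (forall Z : 'M[R]_(n1, n2),
     prox (shifted_potential g gamma a b) Z
       = [set shifted_denoiser g gamma a b Z]) /\
  weakly_convex (gamma * L / (gamma * L + 1)) (shifted_potential g gamma a b).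
Proof.
move=> [gC1 _ _] L0 gL /andP[gamma0 _] gammaL a0.
pose aff (Z : 'M[R]_(n1, n2)) := a *: Z + const_mx b.
have affB X Y : aff X - aff Y = a *: (X - Y).
  by rewrite /aff opprD addrACA subrr addr0 -scalerBr.
have affK U Z : aff U = denoiser g gamma (aff Z) ->
    U = shifted_denoiser g gamma a b Z.
  move=> UZ; rewrite /shifted_denoiser -/(aff Z) -UZ addrK scalerA mulVf ?scale1r//.
  by rewrite gt_eqF.
have affDZ Z : aff (shifted_denoiser g gamma a b Z) = denoiser g gamma (aff Z).
  by rewrite /aff /shifted_denoiser scalerA mulfV ?gt_eqF// scale1r subrK.
have surj U : exists Y, aff U = denoiser g gamma Y.
  by have [Y] := denoiser_surj _ _ _ L0 gL gamma0 gammaL (aff U); exists Y.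
have potE U Y : aff U = denoiser g gamma Y ->
    shifted_potential g gamma a b U = (a ^- 2 * denoiser_energy g gamma Y)%:E.
  rewrite /shifted_potential -/(aff U) => ->.
  by rewrite (potential_denoiser _ _ _ gL gamma0 gammaL).
(* Surjectivity of the denoiser excludes the value [+oo], so real arithmetic suffices from here
   on. *)
have [p [-> pE]] : exists p : 'M[R]_(n1, n2) -> R,
    shifted_potential g gamma a b = (fun U => (p U)%:E) /\
    forall U Y, aff U = denoiser g gamma Y ->
      p U = a ^- 2 * denoiser_energy g gamma Y.
  exists (fun U => fine (shifted_potential g gamma a b U)); split.
    by apply/funext => U; have [Y /potE ->] := surj U.
  by move=> U Y /potE ->.
have ia2 : 0 < a ^- 2 by rewrite invr_gt0 exprn_gt0.
(* The unshifted proximal objective at [aff Z], in the preimage variable. As [aff] scales squared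
   distances by [a ^+ 2], the factor [a ^- 2] of the potential makes the two objectives
   proportional. *)
pose cost Y Z : R := denoiser_energy g gamma Y + 2^-1 *
  frobenius_dot (denoiser g gamma Y - aff Z) (denoiser g gamma Y - aff Z).
have costE U Y Z : aff U = denoiser g gamma Y ->
    p U + 2^-1 * frobenius_norm (U - Z) ^+ 2 = a ^- 2 * cost Y Z.
  move=> UY; rewrite /cost (pE _ _ UY) -UY affB sqr_frobenius_norm.
  rewrite frobenius_dotZl frobenius_dotZr.
  by field; rewrite gt_eqF.
have le_cost U Y V W Z : aff U = denoiser g gamma Y ->
    aff V = denoiser g gamma W ->
    ((p U)%:E + (2^-1 * frobenius_norm (U - Z) ^+ 2)%:E <=
     (p V)%:E + (2^-1 * frobenius_norm (V - Z) ^+ 2)%:E)%E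
    = (cost Y Z <= cost W Z).
  move=> UY VW; rewrite -!EFinD lee_fin.
  by rewrite (costE _ _ _ UY) (costE _ _ _ VW) ler_pM2l.
split=> [Z|].
  have gap Y := denoiser_energy_gap _ _ _ gC1 gL gamma0 Y (aff Z).
  apply/seteqP; split=> [U /= Umin|_ /= -> V].
    apply: affK; have [Y UY] := surj U.
    (* Comparing a minimizer with the shifted denoiser at [Z] makes the gap term nonpositive, whence
       [Y = aff Z]. *)
    have le := etrans (esym (le_cost _ _ _ _ Z UY (affDZ Z))) (Umin _).
    have := le_trans (gap Y) le.
    rewrite gerDl pmulr_rle0 => [N0|]; last by rewrite divr_gt0 ?subr_gt0.
    have /frobenius_dot_eq0/subr0_eq YZ :
        frobenius_dot (Y - aff Z) (Y - aff Z) = 0.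
      by apply/eqP; rewrite eq_le N0 frobenius_dot_ge0.
    by rewrite UY; congr denoiser.
  have [Y VY] := surj V.
  apply: (etrans (le_cost _ _ _ _ Z (affDZ Z) VY)); apply: le_trans (gap Y).
  by rewrite lerDl mulr_ge0 ?frobenius_dot_ge0// divr_ge0// subr_ge0 ltW.
have gL0 : 0 <= gamma * L by rewrite mulr_ge0.
split=> [|X1 X2 t t01]; first by rewrite divr_ge0// addr_ge0.
have [Y1 E1] := surj X1; have [Y2 E2] := surj X2.
have [Y E] := surj (t *: X1 + (1 - t) *: X2).
rewrite -!EFinD lee_fin (pE _ _ E1) (pE _ _ E2) (pE _ _ E).
have DY : denoiser g gamma Y =
    t *: denoiser g gamma Y1 + (1 - t) *: denoiser g gamma Y2.
  rewrite -E -E1 -E2 /aff; apply/matrixP => i j; rewrite !mxE; ring.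
have := denoiser_energy_semiconvex _ _ _ gC1 L0 gL gamma0 gammaL _ _ _ _ t01 DY.
rewrite -E1 -E2 affB !sqr_frobenius_norm => /(ler_wpM2l (ltW ia2)) le.
set N := frobenius_dot (_ + _) _.
apply: le_trans (lerD le (lexx (_ * N))) _.
(* The defect of [|.|^2] on a segment is [t (1 - t) |X1 - X2|^2]; the powers of [a] cancel, so the
   modulus survives the shift. *)
move: (gamma * L / _) => rho; rewrite {}/N !frobenius_dotE (frobenius_dotC X2 X1).
rewrite le_eqVlt; apply/orP; left; apply/eqP.
move: (denoiser_energy g gamma Y1) (denoiser_energy g gamma Y2).
move: (frobenius_dot X1 X1) (frobenius_dot X1 X2) (frobenius_dot X2 X2).
by move=> *; field; rewrite gt_eqF.
Qed.
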